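(* (i) Let $G=(U,\alpha,\phi_G)$ and $H=(V,\beta,\phi_H)$ be fully supported graphs with augmented label functions $\psi_G,\psi_H$. Then $\rho_\Psi(G,H)>0$ if and only if $\rho_{\Psi^*}(G,H)>0$. (ii) Let $\mathcal{G}$ be a family of fully supported graphs with augmented labeling scheme $\Psi$. Then OGJ with cost $c_\Psi$ detects and identifies isomorphism for $\mathcal{G}$ if and only if OGJ with cost $c_{\Psi^*}$ detects and identifies isomorphism for $\mathcal{G}$.
   Context: A weight function on a finite set $U$ is $\alpha:U\times U\to\mathbb{R}$ with $\alpha\ge0$, $\alpha$ symmetric and $\sum_{u,u'}\alpha(u,u')=1$; its marginal is $p(u)=\sum_{u'}\alpha(u,u')$. A graph is $G=(U,\alpha,\phi_G)$ with $U$ finite and primary label function $\phi_G:U\to\mathcal{L}$. $G$ is fully supported if $p(u)>0$ for all $u$. Graphs $G,H$ are isomorphic ($G\cong H$) if there is a bijection $f:U\to V$ with $\alpha(u,u')=\beta(f(u),f(u'))$ and $\phi_G(u)=\phi_H(f(u))$. Weight joinings: for $\alpha$ on $U$ (marginal $p$) and $\beta$ on $V$ (marginal $q$), a weight joining is a weight function $\gamma$ on $U\times V$ with marginal $r_\gamma(u,v)=\sum_{u',v'}\gamma((u,v),(u',v'))$ satisfying $\sum_v r_\gamma(u,v)=p(u)$, $\sum_u r_\gamma(u,v)=q(v)$, $p(u)\sum_{\tilde v}\gamma((u,v),(u',\tilde v))=\alpha(u,u')r_\gamma(u,v)$ and $q(v)\sum_{\tilde u}\gamma((u,v),(\tilde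 u,v'))=\beta(v,v')r_\gamma(u,v)$ for all $u,u',v,v'$; $\mathcal{J}(\alpha,\beta)$ denotes their set. Bijective: for each $u$ a unique $v$ with $r_\gamma(u,v)>0$, and for each $v$ a unique $u$. An augmented labeling scheme $\Psi$ assigns to each graph $G$ a label function $\psi_G=(\phi_G,\phi'_G)$ (primary label plus a secondary label $\phi'_G$). For a label scheme $\Psi$, $c_\Psi(u,v)=\mathbb{I}(\psi_G(u)\neq\psi_H(v))$, $\rho_\Psi(G,H)=\min_{\gamma\in\mathcal{J}(\alpha,\beta)}\sum_{u,v}c_\Psi(u,v)r_\gamma(u,v)$, $\mathcal{J}^*_\Psi(\alpha,\beta)$ the set of minimizers. Process-level labels: for fully supported $G$, let $P(u'|u)=\alpha(u,u')/p(u)$ and for $u\in U$ let $X^u=X^u_0,X^u_1,\dots$ be the Markov chain with $X^u_0=u$ and transition matrix $P$. Define $\psi^*_G(u)=\mathrm{Law}(\psi_G(X^u_0),\psi_G(X^u_1),\dots)$; $\Psi^*=\{\psi^*_G\}$ and $c_{\Psi^*}(u,v)=\mathbb{I}(\psi^*_G(u)\ne\psi^*_H(v))$, with $\rho_{\Psi^*}$, $\mathcal{J}^*_{\Psi^*}$ defined analogously. For a label scheme $\Lambda$ (here $\Psi$ or $\Psi^*$): OGJ with cost $c_\Lambda$ detects isomorphism for $\mathcal{G}$ if for all $G,H\in\mathcal{G}$, $\rho_\Lambda(G,H)=0\iff G\cong H$; it identifies isomorphism for $\mathcal{G}$ if for every isomorphic pair $G=(U,\alpha,\phi_G),H=(V,\beta,\phi_H)$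 in $\mathcal{G}$ the extreme points of $\mathcal{J}^*_\Lambda(\alpha,\beta)$ are exactly the bijective $\gamma\in\mathcal{J}(\alpha,\beta)$ with $\sum c_\Lambda r_\gamma=0$. *)

(* Defs.v *)
From HB Require Import structures.
From mathcomp Require Import all_boot all_order all_algebra.
From mathcomp Require Import all_classical all_reals all_analysis.

Set Implicit Arguments.
Unset Strict Implicit.
Unset Printing Implicit Defensive.

Import Order.TTheory GRing.Theory Num.Theory.

Local Open Scope classical_set_scope.
Local Open Scope ring_scope.

Section WeightFunctions.
Context {R : realType}.

Definition weight_function (U : finType) (a : U -> U -> R) : Prop :=
  [/\ forall u u', 0 <= a u u',
      forall u u', a u u' = a u' u
    & \sum_u \sum_u' a u u' = 1].

Definition marginal (U : finType) (a : U -> U -> R) (u : U) : R :=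
  \sum_u' a u u'.

Section Joinings.
Context {U V : finType} (a : U -> U -> R) (b : V -> V -> R).

Definition weight_joinings : set (U * V -> U * V -> R) :=
  [set g | weight_function g /\
    [/\ forall u, \sum_v marginal g (u, v) = marginal a u,
        forall v, \sum_u marginal g (u, v) = marginal b v,
        forall u u' v,
          marginal a u * \sum_v' g (u, v) (u', v') =
          a u u' * marginal g (u, v)
      & forall u v v',
          marginal b v * \sum_u' g (u, v) (u', v') =
          b v v' * marginal g (u, v)]].

Definition bijective_joining (g : U * V -> U * V -> R) : Prop :=
  (forall u, exists! v, 0 < marginal g (u, v)) /\
  (forall v, exists! u, 0 < marginal g (u, v)).

Definition joining_cost (c : U -> V -> R) (g : U * V -> U * V -> R) : R :=
  \sum_u \sum_v c u v * marginal g (u, v).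

(* The joinings form a nonempty compact polytope on which the cost is linear,
   so this infimum is a minimum. *)
Definition ogj_value (c : U -> V -> R) : R :=
  inf [set joining_cost c g | g in weight_joinings].

Definition optimal_joinings (c : U -> V -> R) :
    set (U * V -> U * V -> R) :=
  [set g | weight_joinings g /\
    forall g', weight_joinings g' -> joining_cost c g <= joining_cost c g'].

End Joinings.

Definition extreme_points (W : finType) (S : set (W -> W -> R)) :
    set (W -> W -> R) :=
  [set g | S g /\
    forall g1 g2 (t : R), S g1 -> S g2 -> 0 < t < 1 ->
      (forall w w', g w w' = t * g1 w w' + (1 - t) * g2 w w') -> g1 = g2].

End WeightFunctions.

Record graph (R : realType) (L : Type) := Graph {
  vertex :> finType;
  weight : vertex -> vertex -> R;
  label : vertex -> L;
  weightP : weight_function weight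
}.

Definition fully_supported (R : realType) (L : Type) (G : graph R L) : Prop :=
  forall u : G, 0 < marginal (@weight R L G) u.

Definition isomorphic (R : realType) (L : Type) (G H : graph R L) : Prop :=
  exists f : G -> H,
    [/\ bijective f,
        forall u u', weight u u' = weight (f u) (f u')
      & forall u, label u = label (f u)].

Section LabelCost.
Context {R : realType} {L K : Type}.

Definition label_cost {U V : Type} (psiG : U -> K) (psiH : V -> K)
    (u : U) (v : V) : R :=
  `[< psiG u <> psiH v >]%:R.

Definition rho (G H : graph R L) (psiG : G -> K) (psiH : H -> K) : R :=
  ogj_value (@weight R L G) (@weight R L H) (label_cost psiG psiH).

Definition rho_optimal (G H : graph R L) (psiG : G -> K) (psiH : H -> K) :
    set (G * H -> G * H -> R) :=
  optimal_joinings (@weight R L G) (@weight R L H) (label_cost psiG psiH).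

End LabelCost.

Definition augmented (R : realType) (L L' : Type) (G : graph R L)
    (phi' : G -> L') (u : G) : L * L' :=
  (label u, phi' u).

Definition transition (R : realType) (L : Type) (G : graph R L) (u u' : G) : R :=
  weight u u' / marginal (@weight R L G) u.

(* The vertex set carries the discrete sigma-algebra.  The last clause is the
   Markov property multiplied out, which avoids conditioning on null events. *)
Definition markov_chain_from (R : realType) (L : Type) (G : graph R L) (u : G)
    (d : measure_display) (T : measurableType d) (P : probability T R)
    (X : nat -> T -> G) : Prop :=
  [/\ forall n x, measurable (X n @^-1` [set x]),
      forall t, X 0%N t = u
    & forall (n : nat) (x : nat -> G),
        P [set t | forall i, (i <= n.+1)%N -> X i t = x i] =
        (P [set t | forall i, (i <= n)%N -> X i t = x i] *
         (transition (x n) (x n.+1))%:E)%E].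

(* The product sigma-algebra on sequences over the discrete space K. *)
Definition sequence_events (K : Type) : set (set (nat -> K)) :=
  <<s [set A | exists (n : nat) (B : set K), A = [set s | B (s n)]] >>.

(* Library measures are total functions on all sets, with unspecified values
   on non-measurable ones; cutting off outside the sigma-algebra makes Leibniz
   equality of laws coincide with equality of probability measures. *)
Definition process_law (R : realType) (K : Type)
    (d : measure_display) (T : measurableType d) (P : probability T R)
    (Y : nat -> T -> K) : set (nat -> K) -> \bar R :=
  patch (cst (0 : \bar R)%E) (@sequence_events K)
    (fun A => P [set t | A (fun n => Y n t)]).

(* The law of (psi (X 0), psi (X 1), ...) for a Markov chain X issued from u.
   When G is fully supported such a chain exists, and all of them, on whatever
   probability space, give the same law. *)
Definition process_label (R : realType) (L K : Type) (G : graph R L)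
    (psi : G -> K) (u : G) : set (nat -> K) -> \bar R :=
  xget (cst (0 : \bar R)%E)
    [set mu | exists (d : measure_display) (T : measurableType d)
                (P : probability T R) (X : nat -> T -> G),
       markov_chain_from u P X /\
       mu = process_law P (fun n t => psi (X n t))].

Section LabelSchemes.
Context {R : realType} {L : Type}.

Definition label_scheme (K : Type) := forall G : graph R L, G -> K.

Definition augmented_scheme (L' : Type) (phi' : label_scheme L') :
    label_scheme (L * L') :=
  fun G => augmented (phi' G).

Definition process_scheme (K : Type) (Psi : label_scheme K) :
    label_scheme (set (nat -> K) -> \bar R) :=
  fun G => process_label (Psi G).

Definition detects_isomorphism (K : Type) (F : graph R L -> Prop)
    (Psi : label_scheme K) : Prop :=
  forall G H, F G -> F H -> (rho (Psi G) (Psi H) = 0 <-> isomorphic G H).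

Definition identifies_isomorphism (K : Type) (F : graph R L -> Prop)
    (Psi : label_scheme K) : Prop :=
  forall G H, F G -> F H -> isomorphic G H ->
    extreme_points (rho_optimal (Psi G) (Psi H)) =
    [set g | [/\ weight_joinings (@weight R L G) (@weight R L H) g,
                 bijective_joining g
               & joining_cost (label_cost (Psi G) (Psi H)) g = 0]].

End LabelSchemes.

Arguments label_scheme R L K : clear implicits.

(* Main.v *)
(* A joining has zero label cost iff it charges only pairs with equal labels, and
   the label cost and the process-label cost have the same zero-cost joinings.
   If every charged pair has equal labels, then moving two chains jointly by the
   conditional law of the second step of the joining keeps them on charged
   pairs, so by induction the probabilities of label cylinders agree; a pi-lambda
   argument turns this into equality of laws. Conversely the initial coordinate
   of a process label is the label itself; this needs a Markov chain to exist,
   and one is built from a single uniform variable by nested intervals. Since the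
   joinings are compact, each value is attained, hence it vanishes iff some
   joining has zero cost. *)
From HB Require Import structures.
Require Import Defs.
From mathcomp Require Import all_boot all_order all_algebra.
From mathcomp Require Import all_classical all_reals all_analysis.
From mathcomp Require Import ring.

Set Implicit Arguments.
Unset Strict Implicit.
Unset Printing Implicit Defensive.

Import Order.TTheory GRing.Theory Num.Theory.
Import numFieldNormedType.Exports.

Local Open Scope classical_set_scope.
Local Open Scope ring_scope.

(** * Elementary facts on weight functions and joinings *)

Section Joinings.
Context {R : realType}.

Lemma marginal_ge0 (U : finType) (a : U -> U -> R) u :
  weight_function a -> 0 <= marginal a u.
Proof. by case=> a0 _ _; apply: sumr_ge0. Qed.

Lemma weight_le_marginal (U : finType) (a : U -> U -> R) u u' :
  weight_function a -> a u u' <= marginal a u.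
Proof.
move=> [a0 _ _]; rewrite /marginal (bigD1 u')//= lerDl.
by apply: sumr_ge0.
Qed.

Lemma weight_gt0_marginal (U : finType) (a : U -> U -> R) u u' :
  weight_function a -> 0 < a u u' -> 0 < marginal a u'.
Proof.
move=> wa; have [_ aC _] := wa; rewrite aC => /lt_le_trans; apply.
exact: weight_le_marginal.
Qed.

Section TwoWeights.
Context {U V : finType} (a : U -> U -> R) (b : V -> V -> R).
Hypotheses (wa : weight_function a) (wb : weight_function b).

Let prod_weight (w w' : U * V) : R := a w.1 w'.1 * b w.2 w'.2.

Let sum_prod (f : U -> R) (g : V -> R) :
  \sum_(w : U * V) f w.1 * g w.2 = (\sum_u f u) * (\sum_v g v).
Proof. by rewrite big_distrlr/= pair_bigA. Qed.

(** The independent product [prod_weight] works: its marginal factors, so the marginal conditions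
    reduce to total mass one and the transition conditions to rearranging products. *)
Lemma joinings_neq0 : weight_joinings a b !=set0.
Proof.
have [a0 aC a1] := wa; have [b0 bC b1] := wb.
have mE w : marginal prod_weight w = marginal a w.1 * marginal b w.2.
  by rewrite /marginal sum_prod.
have wP : weight_function prod_weight.
  split=> [w w'|w w'|]; first exact: mulr_ge0.
    by rewrite /prod_weight aC bC.
  rewrite (eq_bigr (fun w => marginal a w.1 * marginal b w.2)) => [|w _].
    by rewrite sum_prod a1 b1 mulr1.
  exact: mE.
exists prod_weight; split; [exact: wP|split] => [u|v|u u' v|u v v'].
- by under eq_bigr do rewrite mE /=; rewrite -mulr_sumr b1 mulr1.
- by under eq_bigr do rewrite mE /=; rewrite -mulr_suml a1 mul1r.
- by rewrite mE /prod_weight /= -mulr_sumr mulrCA -/(marginal b v).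
- rewrite mE /prod_weight /= -mulr_suml -/(marginal a u).
  by rewrite mulrC -mulrA [RHS]mulrCA.
Qed.

Lemma joining_cost_ge0 (c : U -> V -> R) g :
  (forall u v, 0 <= c u v) -> weight_joinings a b g -> 0 <= joining_cost c g.
Proof.
move=> c0 [wg _]; apply: sumr_ge0 => u _; apply: sumr_ge0 => v _.
by rewrite mulr_ge0 ?marginal_ge0.
Qed.

Lemma joining_cost_eq0 (c : U -> V -> R) g :
  (forall u v, 0 <= c u v) -> weight_joinings a b g ->
  joining_cost c g = 0 <-> (forall u v, 0 < marginal g (u, v) -> c u v = 0).
Proof.
move=> c0 [wg _]; have m0 u v : 0 <= c u v * marginal g (u, v).
  by rewrite mulr_ge0 ?marginal_ge0.
split=> [/psumr_eq0P c00 u v guv|c00].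
  have /psumr_eq0P/(_ v isT)/eqP := c00 (fun u _ => sumr_ge0 _ (fun v _ => m0 u v)) u isT.
  by rewrite mulf_eq0 (gt_eqF guv) orbF => h; apply/eqP/h.
apply: big1 => u _; apply: big1 => v _.
have := marginal_ge0 (u, v) wg; rewrite le_eqVlt => /predU1P[<-|/c00 ->].
  by rewrite mulr0.
by rewrite mul0r.
Qed.

End TwoWeights.
End Joinings.

(** * Propagating label equality along charged pairs *)

Section Coupling.
Context {R : realType} {L : Type}.

Lemma transition_ge0 (G : graph R L) (x y : G) : 0 <= transition x y.
Proof.
by have [a0 _ _] := weightP G; rewrite divr_ge0 ?marginal_ge0 //; exact: weightP.
Qed.

Lemma sum_transition (G : graph R L) (x : G) :
  fully_supported G -> \sum_y transition x y = 1.
Proof. by move=> /(_ x) x0; rewrite -mulr_suml divff// gt_eqF. Qed.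

(* The conditional law of the second step of a joining couples the transition
   rows of [u] and [v] along pairs of positive marginal. *)
Lemma joining_step (G H : graph R L) g (f : G -> R) (h : H -> R) u v :
  fully_supported G -> fully_supported H ->
  weight_joinings (@weight R L G) (@weight R L H) g ->
  (forall u' v', 0 < marginal g (u', v') -> f u' = h v') ->
  0 < marginal g (u, v) ->
  \sum_u' transition u u' * f u' = \sum_v' transition v v' * h v'.
Proof.
move=> fG fH [wg [_ _ gG gH]] fh guv; have [g0 _ _] := wg.
have tG u' : transition u u' =
    (\sum_v' g (u, v) (u', v')) / marginal g (u, v).
  by apply/eqP; rewrite /transition eqr_div ?lt0r_neq0// -gG mulrC.
have tH v' : transition v v' =
    (\sum_u' g (u, v) (u', v')) / marginal g (u, v).
  by apply/eqP; rewrite /transition eqr_div ?lt0r_neq0// -gH mulrC.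
under eq_bigr do rewrite tG mulrAC mulr_suml.
under [RHS]eq_bigr do rewrite tH mulrAC mulr_suml.
rewrite -!mulr_suml [in RHS]exchange_big/=; congr (_ / _).
apply: eq_bigr => u' _; apply: eq_bigr => v' _.
(* Null terms drop out; for the others the symmetry of [g] makes the marginal at [(u', v')]
   positive, so [fh] applies. *)
have := g0 (u, v) (u', v'); rewrite le_eqVlt => /predU1P[<-|gpos].
  by rewrite !mul0r.
by rewrite (fh u' v')//; exact: weight_gt0_marginal gpos.
Qed.

(** Probability that the chain issued from [x] has its labels at times [1] to [m] in [B 0] to
    [B (m - 1)]; the label of [x] itself is not tested. *)
Fixpoint hit_prob (K : Type) (G : graph R L) (psi : G -> K) (m : nat)
    (B : nat -> set K) (x : G) : R :=
  if m is m'.+1 then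
    \sum_y transition x y *
      (`[< B 0%N (psi y) >]%:R * hit_prob psi m' (fun i => B i.+1) y)
  else 1.

(** Induction on [m] over all charged pairs at once: [joining_step] is applied to the label
    indicator times the shorter hitting probability, which agree on charged pairs. *)
Lemma joining_hit_prob (K : Type) (G H : graph R L) (psiG : G -> K)
    (psiH : H -> K) g m B u v :
  fully_supported G -> fully_supported H ->
  weight_joinings (@weight R L G) (@weight R L H) g ->
  (forall u v, 0 < marginal g (u, v) -> psiG u = psiH v) ->
  0 < marginal g (u, v) ->
  hit_prob psiG m B u = hit_prob psiH m B v.
Proof.
move=> fG fH Jg gpsi; elim: m B u v => [//|m IH] B u v guv /=.
apply: (joining_step fG fH Jg) guv => u' v' guv'.
by rewrite (gpsi _ _ guv') (IH _ _ _ guv').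
Qed.

End Coupling.

(** * Compactness of the joinings in the product topology, and attainment of the minimum *)

Section Attainment.
Import ArrowAsProduct.
Context {R : realType} {U V : finType} (a : U -> U -> R) (b : V -> V -> R).

Let joint := (U * V -> U * V -> R)%type.

Let continuous_entry w w' : continuous (fun g : joint => g w w').
Proof.
move=> g; apply: (@continuous_comp _ _ _ (fun g : joint => g w)
  (fun h : U * V -> R => h w')).
  exact: (@proj_continuous _ (fun=> (U * V -> R)) w).
exact: (@proj_continuous _ (fun=> R) w').
Qed.

Let continuous_sum (I : finType) (F : I -> joint -> R) :
  (forall i, continuous (F i)) -> continuous (fun g => \sum_i F i g).
Proof. by move=> cF; apply: continuous_big => //; exact: add_continuous. Qed.

Let continuous_marginal w : continuous (fun g : joint => marginal g w).
Proof. exact: continuous_sum. Qed.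

Let continuous_scale (k : R) (F : joint -> R) :
  continuous F -> continuous (fun g => k * F g).
Proof. by move=> cF g; apply: continuousM; [exact: cst_continuous|exact: cF]. Qed.

Let closed_eq_fun (F F' : joint -> R) :
  continuous F -> continuous F' -> closed [set g | F g = F' g].
Proof.
move=> cF cF'; rewrite [X in closed X](_ : _ =
    (fun g => F g - F' g) @^-1` [set x | x = 0]).
  apply: preimage_closed (@closed_eq _ _) => g _.
  by apply: continuousB; [exact: cF|exact: cF'].
by apply/seteqP; split=> g /= => [->|/eqP]; rewrite ?subrr// subr_eq0 => /eqP.
Qed.

Let closed_forall (I : Type) (S : I -> set joint) :
  (forall i, closed (S i)) -> closed [set g | forall i, S i g].
Proof.
move=> cS; rewrite [X in closed X](_ : _ = \bigcap_i S i).
  by apply: closed_bigI => i _; exact: cS.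
by apply/seteqP; split=> g Sg i //; exact: Sg.
Qed.

(** Each defining condition is an inequality or an equality between continuous functions of the
    finitely many entries. *)
Let closed_joinings : closed (weight_joinings a b : set joint).
Proof.
pose S1 : set joint := [set g | forall w w', 0 <= g w w'].
pose S2 : set joint := [set g | forall w w', g w w' = g w' w].
pose S3 : set joint := [set g | \sum_w \sum_w' g w w' = 1].
pose S4 : set joint :=
  [set g | forall u, \sum_v marginal g (u, v) = marginal a u].
pose S5 : set joint :=
  [set g | forall v, \sum_u marginal g (u, v) = marginal b v].
pose S6 : set joint := [set g | forall u u' v,
  marginal a u * \sum_v' g (u, v) (u', v') = a u u' * marginal g (u, v)].
pose S7 : set joint := [set g | forall u v v',
  marginal b v * \sum_u' g (u, v) (u', v') = b v v' * marginal g (u, v)].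
rewrite (_ : weight_joinings a b =
    S1 `&` S2 `&` S3 `&` S4 `&` S5 `&` S6 `&` S7); last first.
  by apply/seteqP; split=> g; [case=> -[? ? ?] [? ? ? ?]|
    case=> -[[[[[? ?] ?] ?] ?] ?] ?]; do !split.
do !apply: closedI.
- apply: closed_forall => w; apply: closed_forall => w'.
  exact: (@preimage_closed _ _ (fun g : joint => g w w') _
    (fun g _ => @continuous_entry w w' g) (@closed_ge _ 0)).
- apply: closed_forall => w; apply: closed_forall => w'.
  exact: closed_eq_fun.
- apply: closed_eq_fun; last by move=> ?; exact: cst_continuous.
  by do !apply: continuous_sum => ?.
- apply: closed_forall => u; apply: closed_eq_fun.
    exact: continuous_sum.
  by move=> ?; exact: cst_continuous.
- apply: closed_forall => v; apply: closed_eq_fun.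
    exact: continuous_sum.
  by move=> ?; exact: cst_continuous.
- do 3!apply: closed_forall => ?; apply: closed_eq_fun.
    by apply: continuous_scale; exact: continuous_sum.
  exact: continuous_scale.
- do 3!apply: closed_forall => ?; apply: closed_eq_fun.
    by apply: continuous_scale; exact: continuous_sum.
  exact: continuous_scale.
Qed.

(** A closed subset of the unit cube; as joinings are curried functions, Tychonoff's theorem is
    applied once per argument. *)
Let compact_joinings : compact (weight_joinings a b : set joint).
Proof.
pose box : set joint :=
  [set g | forall w, [set h | forall w', `[0, 1]%classic (h w')] (g w)].
apply: (@subclosed_compact _ _ box closed_joinings).
  apply: (@tychonoff _ (fun=> (U * V -> R))
    (fun=> [set h | forall w', `[0, 1]%classic (h w')])) => w.
  apply: (@tychonoff _ (fun=> R) (fun=> `[0, 1]%classic)) => w'.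
  exact: segment_compact.
move=> g [wg _] w w' /=; have [g0 _ g1] := wg; rewrite in_itv/= g0 -g1.
(* An entry is at most its row sum, which is at most the total mass, rewritten here in place of
   [1]. *)
apply: le_trans (weight_le_marginal w w' wg) _.
rewrite (bigD1 w)//= lerDl; apply: sumr_ge0 => ? _.
by apply: sumr_ge0 => ? _.
Qed.

Hypotheses (wa : weight_function a) (wb : weight_function b).

Lemma ogj_value_attained (c : U -> V -> R) :
  exists2 g, weight_joinings a b g & ogj_value a b c = joining_cost c g.
Proof.
have cc : continuous (fun g : joint => joining_cost c g).
  apply: continuous_sum => u; apply: continuous_sum => v.
  exact: continuous_scale.
have [g /set_mem Jg gmin] := compact_EVT_min (joinings_neq0 wa wb)
  compact_joinings (continuous_subspaceT cc).
exists g => //; apply/eqP; rewrite eq_le; apply/andP; split.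
  apply: ge_inf; last by exists g.
  by exists (joining_cost c g) => _ [g' Jg' <-]; apply: gmin; exact/mem_set.
apply: lb_le_inf; first by exists (joining_cost c g), g.
by move=> _ [g' Jg' <-]; apply: gmin; exact/mem_set.
Qed.

End Attainment.

(** * Cylinder probabilities of a Markov chain determine the law of its labels *)

Section ProcessLaws.
Context {R : realType} {L : Type}.

Section Chain.
Context {G : graph R L} {u : G} {d : measure_display} {T : measurableType d}
  {P : probability T R} {X : nat -> T -> G}.
Hypothesis chainX : markov_chain_from u P X.

Lemma measurable_chain n (D : set G) : measurable (X n @^-1` D).
Proof.
have [mX _ _] := chainX.
have -> : X n @^-1` D = \bigcup_(x in D) X n @^-1` [set x].
  apply/seteqP; split=> [t Dt|t [x Dx]]; first by exists (X n t).
  by rewrite /preimage/= => ->.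
by apply: fin_bigcup_measurable => //; exact: finite_finset.
Qed.

(** The offset [k] covers both events about the path from time [0] and events about the future
    alone. *)
Lemma measurable_chain_forall k (Q : nat -> Prop) (D : nat -> set G) :
  measurable [set t | forall i, Q i -> D i (X (k + i)%N t)].
Proof.
rewrite [X in measurable X](_ : _ = \bigcap_(i in Q) X (k + i)%N @^-1` D i) //.
rewrite bigcap_mkcond; apply: bigcapT_measurable => i; case: ifP => // _.
exact: measurable_chain.
Qed.

Lemma prob_chain_split n (E : set T) : measurable E ->
  P E = (\sum_(y : G) P (E `&` X n @^-1` [set y]))%E.
Proof.
move=> mE.
have {1}-> : E = \bigcup_(y in [set` index_enum G]) (E `&` X n @^-1` [set y]).
  apply/seteqP; split=> [t Et|t [y _ []]//].
  by exists (X n t) => //=; exact: mem_index_enum.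
rewrite measure_fin_bigcup -?fsbig_seq ?index_enum_uniq //.
- by move=> x y _ _ [t [[_ <-] [_ <-]]].
- by move=> y _; apply: measurableI => //; exact: measurable_chain.
Qed.

(** The Markov property iterated over [m] future steps: split on the vertex [y] at time [n.+1],
    append it to the path and use the induction hypothesis for the longer path. *)
Lemma markov_hit_prob (K : Type) (psi : G -> K) m B n (x : nat -> G) :
  P [set t | (forall i, (i <= n)%N -> X i t = x i) /\
             (forall j, (j < m)%N -> B j (psi (X (n.+1 + j)%N t)))] =
  (P [set t | forall i, (i <= n)%N -> X i t = x i] *
   (hit_prob psi m B (x n))%:E)%E.
Proof.
have [_ _ XM] := chainX.
elim: m B n x => [|m IH] B n x /=.
  rewrite mule1; congr (P _); apply/seteqP; split=> [t [] //|t Xt].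
  by split.
(* Finiteness turns the path probability into a real factor, over which the sum on [y]
   distributes. *)
have fin_cyl : P [set t | forall i, (i <= n)%N -> X i t = x i] \is a fin_num.
  by apply: fin_num_measure; exact: (measurable_chain_forall 0 _ (fun i => [set x i])).
rewrite (@prob_chain_split n.+1); last first.
  apply: measurableI.
    exact: (measurable_chain_forall 0 _ (fun i => [set x i])).
  exact: (measurable_chain_forall n.+1 _ (fun j => psi @^-1` B j)).
rewrite -[X in (X * _)%E](fineK fin_cyl) -EFinM mulr_sumr -sumEFin.
apply: eq_bigr => y _.
(* The path prolonged by [y]; only its values up to time [n.+1] matter. *)
pose xy i := if (i <= n)%N then x i else y.
have cyl_xy : [set t | forall i, (i <= n)%N -> X i t = xy i] =
              [set t | forall i, (i <= n)%N -> X i t = x i].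
  by apply/seteqP; split=> t Xt i i_n; have := Xt i i_n; rewrite /xy i_n.
have [By|nBy] := pselect (B 0%N (psi y)); last first.
  rewrite (asboolF nBy) mul0r !mulr0; apply: etrans (measure0 P); congr (P _).
  apply/seteqP; split=> // t [[_ Bt] /= Xy]; apply: nBy.
  by have := Bt 0%N isT; rewrite addn0 Xy.
rewrite (asboolT By) mul1r.
(* Since [y] satisfies [B 0], the constraint at time [n.+1] is absorbed into the path and [B] shifts
   by one. *)
transitivity (P [set t | (forall i, (i <= n.+1)%N -> X i t = xy i) /\
             (forall j, (j < m)%N -> B j.+1 (psi (X (n.+2 + j)%N t)))]).
  congr (P _); apply/seteqP; split=> [t [[Xt Bt] /= Xy]|t [/= Xt Bt]].
    split=> [i|j jm].
      rewrite leq_eqVlt ltnS /xy => /predU1P[->|i_n]; first by rewrite ltnn.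
      by rewrite i_n Xt.
    by rewrite addSnnS; exact: Bt.
  have Xy : X n.+1 t = y by rewrite Xt// /xy ltnn.
  split=> //=; split=> [i i_n|[_|j jm]].
  - by rewrite Xt ?(leqW i_n)// /xy i_n.
  - by rewrite addn0 Xy.
  - by rewrite -addSnnS; exact: Bt.
rewrite (IH (fun j => B j.+1) n.+1 xy) XM cyl_xy -[X in (X * _ * _)%E](fineK fin_cyl).
by rewrite -!EFinM /xy leqnn ltnn -mulrA.
Qed.

(** The case of a path reduced to time [0], which is the sure event; the label at time [0] is
    deterministic and gives the indicator in front. *)
Lemma prob_chain_cylinder (K : Type) (psi : G -> K) m B :
  P [set t | forall i, (i <= m)%N -> B i (psi (X i t))] =
  (`[< B 0%N (psi u) >]%:R * hit_prob psi m (fun i => B i.+1) u)%:E.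
Proof.
have [_ X0 _] := chainX.
have cyl0 : [set t | forall i, (i <= 0)%N -> X i t = u] = setT.
  by apply/seteqP; split=> // t _ i /=; rewrite leqn0 => /eqP ->.
have [Bu|nBu] := pselect (B 0%N (psi u)); last first.
  rewrite (asboolF nBu) mul0r; apply: etrans (measure0 P); congr (P _).
  by apply/seteqP; split=> // t /(_ 0%N isT); rewrite X0.
rewrite (asboolT Bu) mul1r.
have := markov_hit_prob psi m (fun i => B i.+1) 0 (fun=> u).
rewrite cyl0 probability_setT mul1e => <-; congr (P _).
apply/seteqP; split=> [t Bt|t [Xt Bt] [_|i im]].
- split=> [i|j jm]; first by rewrite leqn0 => /eqP ->.
  exact: Bt.
- by rewrite X0.
- exact: Bt.
Qed.

End Chain.

(** Constraining a whole initial segment, rather than one coordinate, yields a family closed under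
    intersection, as the pi-lambda theorem requires. *)
Definition cylinders (K : Type) : set (set (nat -> K)) :=
  [set A | exists (m : nat) (B : nat -> set K),
     A = [set s | forall i, (i <= m)%N -> B i (s i)]].

Lemma setI_closed_cylinders (K : Type) : setI_closed (@cylinders K).
Proof.
move=> _ _ [m [B ->]] [m' [B' ->]]; exists (maxn m m').
(* Up to the common horizon, each family of constraints is active only within its own horizon. *)
exists (fun i => [set k | ((i <= m)%N -> B i k) /\ ((i <= m')%N -> B' i k)]).
apply/seteqP; split=> [s [Bs B's] i _|s BB's].
  by split=> ?; [exact: Bs|exact: B's].
by split=> i im; apply BB's => //; rewrite leq_max im ?orbT.
Qed.

Lemma sequence_events_cylinders (K : Type) :
  @sequence_events K `<=` <<s @cylinders K >>.
Proof.
apply: sub_sigma_algebra2 => _ [n [B ->]]; exists n.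
exists (fun i => if i == n then B else setT); apply/seteqP; split=> [s Bs i _|s].
  by case: eqP => // ->.
by move=> /(_ n (leqnn n)); rewrite eqxx.
Qed.

(** Dynkin's argument: the sets in [agree] form a lambda-system, which contains the cylinders by
    [prob_chain_cylinder]. *)
Lemma eq_process_law (K : Type) (G H : graph R L) (psiG : G -> K)
    (psiH : H -> K) (u : G) (v : H)
    (d : measure_display) (T : measurableType d) (P : probability T R) X
    (d' : measure_display) (T' : measurableType d') (P' : probability T' R) X' :
  markov_chain_from u P X -> markov_chain_from v P' X' ->
  psiG u = psiH v ->
  (forall m B, hit_prob psiG m B u = hit_prob psiH m B v) ->
  process_law P (fun n t => psiG (X n t)) =
  process_law P' (fun n t => psiH (X' n t)).
Proof.
move=> cX cX' uv huv.
pose Y t n := psiG (X n t); pose Y' t n := psiH (X' n t).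
pose agree := [set A : set (nat -> K) | [/\ measurable (Y @^-1` A),
  measurable (Y' @^-1` A) & P (Y @^-1` A) = P' (Y' @^-1` A)]].
have agree_sub : @sequence_events K `<=` agree.
  apply: subset_trans (@sequence_events_cylinders K) _.
  apply: (lambda_system_subset (@setI_closed_cylinders K)); last 2 first.
  - move=> _ [m [B ->]]; split.
    + exact: (measurable_chain_forall cX 0 _ (fun i => psiG @^-1` B i)).
    + exact: (measurable_chain_forall cX' 0 _ (fun i => psiH @^-1` B i)).
    + rewrite (prob_chain_cylinder cX psiG) (prob_chain_cylinder cX' psiH).
      by rewrite uv huv.
  - by [].
  split=> //.
  - by split; rewrite ?preimage_setT ?probability_setT.
  - move=> A B BA [mA mA' PA] [mB mB' PB]; split.
    + exact: measurableD mA mB.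
    + exact: measurableD mA' mB'.
    + change (P (Y @^-1` A `\` Y @^-1` B) = P' (Y' @^-1` A `\` Y' @^-1` B)).
      (* The subtraction formula applies because probabilities are finite. *)
      rewrite (measureD mA mB) ?(measureD mA' mB').
      + rewrite !(setIidr (preimage_subset BA)); congr (_ - _)%E; [exact: PA|exact: PB].
      + exact: le_lt_trans (probability_le1 _ mA') (ltry 1).
      + exact: le_lt_trans (probability_le1 _ mA) (ltry 1).
  (* Increasing unions: continuity from below for both measures, then uniqueness of limits. *)
  - move=> F ndF aF.
    have mF n : measurable (Y @^-1` F n) by have [] := aF n.
    have mF' n : measurable (Y' @^-1` F n) by have [] := aF n.
    split; rewrite ?preimage_bigcup; try exact: bigcupT_measurable.
    have cvgP : (P \o (fun n => Y @^-1` F n)) x @[x --> \oo] -->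
        P (\bigcup_n (Y @^-1` F n)).
      apply: nondecreasing_cvg_mu => //; first exact: bigcupT_measurable.
      move=> i j ij; apply/subsetPset; apply: preimage_subset.
      by apply/subsetPset; exact: ndF.
    have cvgP' : (P' \o (fun n => Y' @^-1` F n)) x @[x --> \oo] -->
        P' (\bigcup_n (Y' @^-1` F n)).
      apply: nondecreasing_cvg_mu => //; first exact: bigcupT_measurable.
      move=> i j ij; apply/subsetPset; apply: preimage_subset.
      by apply/subsetPset; exact: ndF.
    rewrite -(cvg_lim _ cvgP)// -(cvg_lim _ cvgP')//.
    by congr (limn _); apply/funext => n /=; have [] := aF n.
(* Outside [sequence_events] the cutoff makes both sides zero. *)
apply/funext => A; rewrite /process_law /patch; case: ifPn => //.
by rewrite inE => /agree_sub[].
Qed.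

End ProcessLaws.

(** * Cutting the unit interval according to a finite distribution *)

Section Cumulative.
Context {R : realType} {T : finType} (w : T -> R).
Hypotheses (w0 : forall y, 0 <= w y) (w1 : \sum_y w y = 1).

(** Distribution function of [w] along the enumeration of [T]: its values at consecutive ranks bound
    half-open intervals, that of [y] having length [w y]. *)
Definition cumulative (k : nat) : R := \sum_(z | (enum_rank z < k)%N) w z.

Lemma cumulativeS y :
  cumulative (enum_rank y).+1 = cumulative (enum_rank y) + w y.
Proof.
rewrite /cumulative (bigD1 y) ?ltnS//= addrC; congr (_ + _).
apply: eq_bigl => z; rewrite ltnS [RHS]ltn_neqAle andbC; congr (_ && _).
by rewrite -(inj_eq enum_rank_inj).
Qed.

Lemma cumulative_le k l : (k <= l)%N -> cumulative k <= cumulative l.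
Proof.
move=> kl; rewrite /cumulative [leRHS]big_mkcond [leLHS]big_mkcond/=.
apply: ler_sum => z _; case: ifPn => [zk|_]; first by rewrite (leq_trans zk kl).
by case: ifP.
Qed.

Lemma cumulative_ge0 k : 0 <= cumulative k.
Proof. exact: sumr_ge0. Qed.

Lemma cumulative_full k : (#|T| <= k)%N -> cumulative k = 1.
Proof.
move=> Tk; rewrite -w1; apply: eq_bigl => z.
by rewrite (leq_trans (ltn_ord _) Tk).
Qed.

Lemma cumulative_le1 k : cumulative k <= 1.
Proof.
by rewrite -w1 /cumulative [leLHS]big_mkcond ler_sum// => z _; case: ifP.
Qed.

Lemma cumulative_exists (s : R) : 0 <= s < 1 ->
  exists y : T, cumulative (enum_rank y) <= s < cumulative (enum_rank y).+1.
Proof.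
move=> /andP[s0 s1].
have ex_k : exists k, s < cumulative k.
  by exists #|T|; rewrite cumulative_full.
(* The vertex sought has rank one less than the least such index, which is not [0] because an empty
   sum cannot exceed [s]. *)
case: (ex_minnP ex_k) => -[|k] sk kmin.
  by move: sk; rewrite /cumulative big_pred0// ltNge s0.
have ks : cumulative k <= s.
  by rewrite leNgt; apply/negP => /kmin; rewrite ltnn.
have kT : (k < #|T|)%N.
  by rewrite ltnNge; apply/negP => /cumulative_full k1; move: ks; rewrite k1 leNgt s1.
by exists (enum_val (Ordinal kT)); rewrite enum_valK/= ks sk.
Qed.

Lemma cumulative_unique s (y z : T) :
  cumulative (enum_rank y) <= s < cumulative (enum_rank y).+1 ->
  cumulative (enum_rank z) <= s < cumulative (enum_rank z).+1 -> y = z.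
Proof.
move=> /andP[ys sy] /andP[zs sz]; apply/enum_rank_inj/ord_inj.
have [yz|zy|//] := ltngtP (enum_rank y) (enum_rank z).
  by have := lt_le_trans sy (cumulative_le yz); rewrite ltNge zs.
by have := lt_le_trans sz (cumulative_le zy); rewrite ltNge ys.
Qed.

End Cumulative.

(** * The uniform law on the unit interval *)

Section UnitInterval.
Context {R : realType}.

(** A measure on the whole line, for which the complement of [[0, 1[] is null. *)
Definition unit_interval_prob : set (measurableTypeR R) -> \bar R :=
  mrestr lebesgue_measure (measurable_itv `[0, 1[%R).

HB.instance Definition _ := Measure.on unit_interval_prob.

Let unit_interval_probT : unit_interval_prob setT = 1%E.
Proof.
by rewrite /unit_interval_prob /mrestr setTI lebesgue_measure_itv/= lte01 oppr0 adde0.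
Qed.

HB.instance Definition _ :=
  Measure_isProbability.Build _ _ R unit_interval_prob unit_interval_probT.

End UnitInterval.

(* The chain is driven by a single uniform variable [s]: the trajectories
   following a path [x] up to time [n] are those with [s] in the interval of
   left end [path_lo x n] and length [path_len x n]; the state records the
   current vertex and the position of [s] rescaled within that interval. *)
Section ChainExistence.
Context {R : realType} {L : Type} (G : graph R L) (u : G).
Hypothesis fG : fully_supported G.

Let cum (x : G) := cumulative (transition x).

(** The default [x] is never taken when [s] lies in [[0, 1[]. *)
Definition next_vertex (x : G) (s : R) : G :=
  odflt x [pick y | cum x (enum_rank y) <= s < cum x (enum_rank y).+1].

Definition next_state (xs : G * R) : G * R :=
  let y := next_vertex xs.1 xs.2 in
  (y, (xs.2 - cum xs.1 (enum_rank y)) / transition xs.1 y).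

(** Seeds outside [[0, 1[], a null set, follow the trajectory of [0]. *)
Definition uniform_chain (n : nat) (s : measurableTypeR R) : G :=
  (iter n next_state (u, if 0 <= s < 1 then s else 0)).1.

Definition path_len (x : nat -> G) (n : nat) : R :=
  \prod_(i < n) transition (x i) (x i.+1).

Fixpoint path_lo (x : nat -> G) (n : nat) : R :=
  if n is n'.+1 then
    path_lo x n' + path_len x n' * cum (x n') (enum_rank (x n'.+1))
  else 0.

Let path_itv x n s := path_lo x n <= s < path_lo x n + path_len x n.

Lemma next_vertexP x (s : R) y : 0 <= s < 1 ->
  next_vertex x s = y <-> cum x (enum_rank y) <= s < cum x (enum_rank y).+1.
Proof.
move=> s01; rewrite /next_vertex; case: pickP => [z zs|none]/=.
  by split=> [<-//|ys]; apply: cumulative_unique zs ys; exact: transition_ge0.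
by have [z] := cumulative_exists (sum_transition x fG) s01; rewrite none.
Qed.

Lemma path_lenS x n :
  path_len x n.+1 = path_len x n * transition (x n) (x n.+1).
Proof. by rewrite /path_len big_ord_recr. Qed.

Lemma path_len_ge0 x n : 0 <= path_len x n.
Proof. by apply: prodr_ge0 => i _; exact: transition_ge0. Qed.

Lemma path_hiS x n : path_lo x n.+1 + path_len x n.+1 =
  path_lo x n + path_len x n * cum (x n) (enum_rank (x n.+1)).+1.
Proof. by rewrite path_lenS /= /cum cumulativeS mulrDr addrA. Qed.

(** The intervals are nested because cumulative values lie between [0] and [1]. *)
Lemma path_itvW x n (s : R) : path_itv x n.+1 s -> path_itv x n s.
Proof.
rewrite /path_itv path_hiS /= => /andP[los shi]; apply/andP; split.
  apply: le_trans los; rewrite lerDl mulr_ge0 ?path_len_ge0//.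
  exact/cumulative_ge0/transition_ge0.
apply: lt_le_trans shi _; rewrite lerD2l ler_piMr ?path_len_ge0//.
exact: (cumulative_le1 (transition_ge0 _) (sum_transition _ fG)).
Qed.

Lemma path_itv_len x n (s : R) : path_itv x n s -> 0 < path_len x n.
Proof. by move=> /andP[los shi]; have := le_lt_trans los shi; rewrite ltrDl. Qed.

Lemma path_itv01 x n (s : R) : path_itv x n s -> 0 <= s < 1.
Proof.
elim: n => [|n IH /path_itvW//].
by rewrite /path_itv /path_len big_ord0 /= add0r.
Qed.

Lemma path_itv_rescaled x n (s : R) : path_itv x n s ->
  0 <= (s - path_lo x n) / path_len x n < 1.
Proof.
move=> xs; have l0 := path_itv_len xs; move: xs => /andP[los shi].
by rewrite divr_ge0 ?subr_ge0 ?path_len_ge0//= ltr_pdivrMr// mul1r ltrBlDl.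
Qed.

(** Rescaling the current interval onto [[0, 1[] carries its subintervals to those that
    [next_vertex] tests; the length is positive as [s] lies inside. *)
Lemma path_itvS x n (s : R) : path_itv x n s ->
  path_itv x n.+1 s <->
  next_vertex (x n) ((s - path_lo x n) / path_len x n) = x n.+1.
Proof.
move=> xs; have l0 := path_itv_len xs; rewrite next_vertexP; last first.
  exact: path_itv_rescaled.
rewrite /path_itv path_hiS /= ler_pdivlMr// ltr_pdivrMr//.
by rewrite lerBrDl ltrBlDl ![_ * path_len x n]mulrC.
Qed.

Lemma path_state x n (s : R) : x 0%N = u -> path_itv x n s ->
  iter n next_state (u, s) = (x n, (s - path_lo x n) / path_len x n).
Proof.
move=> x0; elim: n => [|n IH] xs.
  by rewrite /= x0 subr0 /path_len big_ord0 divr1.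
have xsW := path_itvW xs; rewrite iterS (IH xsW) /next_state/=.
have /path_itvS-/(_ xsW) := xs => ->; congr (_, _).
(* The interval at time [n.+1] contains [s], so its length and both factors of that length are
   nonzero, which justifies the divisions. *)
have := path_itv_len xs; rewrite path_lenS => l0.
have l1 : path_len x n != 0 by rewrite lt0r_neq0// (path_itv_len xsW).
have t1 : transition (x n) (x n.+1) != 0.
  by apply: contraTneq l0 => ->; rewrite mulr0 ltxx.
by field; rewrite l1 t1.
Qed.

(** On the interval, [path_state] locates the chain at every earlier time; conversely, [path_itvS]
    recovers the interval one step at a time. *)
Lemma uniform_chainP x n (s : R) : x 0%N = u -> 0 <= s < 1 ->
  (forall i, (i <= n)%N -> uniform_chain i s = x i) <-> path_itv x n s.
Proof.
move=> x0 s01; rewrite /uniform_chain s01; split; last first.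
  move=> xs i i_n; have xis : path_itv x i s.
    elim: n i_n xs => [|n IH]; first by rewrite leqn0 => /eqP ->.
    by rewrite leq_eqVlt => /predU1P[->//|/IH i_n /path_itvW].
  by rewrite (path_state x0 xis).
elim: n => [_|n IH Xx].
  by rewrite /path_itv /path_len big_ord0 /= add0r.
have xs : path_itv x n s by apply: IH => i i_n; apply: Xx; exact: leqW.
apply/(path_itvS xs); rewrite -(Xx n.+1 (leqnn _)) iterS.
by rewrite (path_state x0 xs).
Qed.

Lemma measurable_uniform_chain n y :
  measurable (uniform_chain n @^-1` [set y]).
Proof.
(* Paths up to time [n] are encoded as finite functions, so the union below is finite. The
   complement of [[0, 1[] lies entirely inside or outside the event, according to the trajectory of
   [0]. *)
pose ext (f : {ffun 'I_n.+1 -> G}) i := f (inord i).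
have -> : uniform_chain n @^-1` [set y] =
  (\bigcup_(f in [set f | ext f 0%N = u /\ ext f n = y])
     [set` `[path_lo (ext f) n, path_lo (ext f) n + path_len (ext f) n[%R]) `|`
  (if uniform_chain n 0 == y then ~` [set` `[0, 1[%R] else set0).
  apply/seteqP; split=> [s <-|s [[f [f0 fy]]|]].
  - have [s01|s01] := boolP (0 <= s < 1).
      left; exists [ffun i : 'I_n.+1 => uniform_chain i s].
        by split; rewrite /ext ffunE inordK.
      rewrite /= in_itv/=; apply/uniform_chainP => //.
        by rewrite /ext ffunE inordK.
      by move=> i i_n; rewrite /ext ffunE inordK.
    right; rewrite {1}/uniform_chain lexx ltr01 /uniform_chain (negbTE s01) eqxx.
    by rewrite /= in_itv/=; exact/negP.
  - rewrite /= in_itv/= => fs; rewrite -fy.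
    by have [_] := uniform_chainP n f0 (path_itv01 fs); apply.
  - case: eqP => // <-; rewrite /= in_itv/= => /negP s01.
    by rewrite /uniform_chain lexx ltr01 (negbTE s01).
apply: measurableU; last by case: ifP => // _; apply: measurableC; exact: measurable_itv.
apply: fin_bigcup_measurable => [|f _]; first exact: finite_finset.
exact: measurable_itv.
Qed.

Lemma prob_uniform_chain n x :
  unit_interval_prob [set s | forall i, (i <= n)%N -> uniform_chain i s = x i] =
  ((x 0%N == u)%:R * path_len x n)%:E.
Proof.
rewrite /unit_interval_prob /mrestr; case: eqP => [x0|x0]; last first.
  rewrite mul0r (_ : _ `&` _ = set0) ?measure0//.
  by apply/seteqP; split=> // s [/(_ 0%N isT) ux _]; apply: x0; rewrite -ux.
rewrite mul1r (_ : _ `&` _ =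
    [set` `[path_lo x n, path_lo x n + path_len x n[%R]); last first.
  apply/seteqP; split=> [s [Xs]|s]; rewrite /= !in_itv/= => s01.
    exact/uniform_chainP.
  by have s01' := path_itv01 s01; split=> //; apply/uniform_chainP.
(* The measure formula distinguishes the empty interval, where the path has length zero. *)
rewrite lebesgue_measure_itv/= lte_fin ltrDl.
case: ifPn => [_|]; first by rewrite -EFinB addrAC subrr add0r.
by rewrite -leNgt => l0; congr EFin; apply/eqP; rewrite eq_le path_len_ge0 l0.
Qed.

Lemma uniform_chain_markov :
  markov_chain_from u (@unit_interval_prob R) uniform_chain.
Proof.
split=> [n x|//|n x]; first exact: measurable_uniform_chain.
apply: etrans (prob_uniform_chain n.+1 x) _.
rewrite path_lenS mulrA EFinM; congr (_ * _)%E.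
exact/esym/prob_uniform_chain.
Qed.

End ChainExistence.

(** * Process labels as laws of actual chains *)

Section ProcessLabels.
Context {R : realType} {L K : Type}.

(** [uniform_chain] shows that the set given to [xget] is nonempty, so the default zero function is
    not selected. *)
Lemma process_labelP (G : graph R L) (psi : G -> K) (u : G) :
  fully_supported G ->
  exists (d : measure_display) (T : measurableType d) (P : probability T R)
    (X : nat -> T -> G), markov_chain_from u P X /\
    process_label psi u = process_law P (fun n t => psi (X n t)).
Proof.
move=> fG; rewrite /process_label; case: xgetP => [mu ->|/(_ _)/=].
  by [].
move=> none; exfalso; apply: none; do 4!eexists; split; last by [].
exact: uniform_chain_markov.
Qed.

Lemma joining_process_label (G H : graph R L) (psiG : G -> K) (psiH : H -> K)
    g u v :
  fully_supported G -> fully_supported H ->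
  weight_joinings (@weight R L G) (@weight R L H) g ->
  (forall u v, 0 < marginal g (u, v) -> psiG u = psiH v) ->
  0 < marginal g (u, v) -> process_label psiG u = process_label psiH v.
Proof.
move=> fG fH Jg gpsi guv.
have [d [T [P [X [cX ->]]]]] := process_labelP psiG u fG.
have [d' [T' [P' [X' [cX' ->]]]]] := process_labelP psiH v fH.
apply: eq_process_law cX cX' (gpsi _ _ guv) _ => m B.
exact: joining_hit_prob fG fH Jg gpsi guv.
Qed.

Lemma process_label_initial (G : graph R L) (psi : G -> K) (u : G) (k : K) :
  fully_supported G ->
  process_label psi u [set s | s 0%N = k] = (`[< psi u = k >]%:R)%:E.
Proof.
move=> fG; have [d [T [P [X [[_ X0 _] ->]]]]] := process_labelP psi u fG.
(* The event constrains a single coordinate, hence lies in [sequence_events] and escapes the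
   cutoff. *)
rewrite /process_law /patch mem_set; last first.
  by apply: sub_sigma_algebra; exists 0%N, [set k].
have [uk|uk] := pselect (psi u = k).
  rewrite asboolT// -(probability_setT P); congr (P _).
  by apply/seteqP; split=> // t _ /=; rewrite X0.
rewrite asboolF//; apply: etrans (measure0 P); congr (P _).
by apply/seteqP; split=> // t /=; rewrite X0.
Qed.

Lemma process_label_inj (G H : graph R L) (psiG : G -> K) (psiH : H -> K) u v :
  fully_supported G -> fully_supported H ->
  process_label psiG u = process_label psiH v -> psiG u = psiH v.
Proof.
(* On this event the law from [v] has value one, while the law from [u] would have value zero if the
   labels differed. *)
move=> fG fH /(congr1 (fun mu => mu [set s | s 0%N = psiH v])).
rewrite !process_label_initial// (asboolT (erefl (psiH v))) => -[].
by case: asboolP => // _ /eqP; rewrite eq_sym oner_eq0.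
Qed.

End ProcessLabels.

(** * Transfer of zero cost, optimal values and optimal joinings between the two label costs *)

Section ZeroCost.
Context {R : realType} {L : Type}.

Lemma label_cost_ge0 (K U V : Type) (psiU : U -> K) (psiV : V -> K) u v :
  0 <= label_cost psiU psiV u v :> R.
Proof. exact: ler0n. Qed.

Lemma label_cost_eq0 (K U V : Type) (psiU : U -> K) (psiV : V -> K) u v :
  label_cost psiU psiV u v = 0 :> R <-> psiU u = psiV v.
Proof.
rewrite /label_cost; case: asboolP => [ne|/contrapT //].
by split=> // /eqP; rewrite oner_eq0.
Qed.

Lemma zero_label_cost (K : Type) (G H : graph R L) (psiG : G -> K)
    (psiH : H -> K) g :
  weight_joinings (@weight R L G) (@weight R L H) g ->
  joining_cost (label_cost psiG psiH) g = 0 <->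
  (forall u v, 0 < marginal g (u, v) -> psiG u = psiH v).
Proof.
move=> Jg; rewrite (joining_cost_eq0 _ Jg); last exact: label_cost_ge0.
by split=> h u v /h /label_cost_eq0.
Qed.

(** From process labels to labels the argument is pair by pair; the converse uses label equality on
    all charged pairs together. *)
Lemma zero_process_label_cost (K : Type) (G H : graph R L) (psiG : G -> K)
    (psiH : H -> K) g :
  fully_supported G -> fully_supported H ->
  weight_joinings (@weight R L G) (@weight R L H) g ->
  joining_cost (label_cost (process_label psiG) (process_label psiH)) g = 0 <->
  joining_cost (label_cost psiG psiH) g = 0.
Proof.
move=> fG fH Jg; rewrite !zero_label_cost//; split=> gpsi u v guv.
  exact: process_label_inj (gpsi _ _ guv).
exact: joining_process_label Jg gpsi guv.
Qed.

Lemma rho_eq0 (K : Type) (G H : graph R L) (psiG : G -> K) (psiH : H -> K) :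
  rho psiG psiH = 0 <->
  exists2 g, weight_joinings (@weight R L G) (@weight R L H) g &
    joining_cost (label_cost psiG psiH) g = 0.
Proof.
have c0 := @label_cost_ge0 _ _ _ psiG psiH.
have [g Jg rhoE] := ogj_value_attained (weightP G) (weightP H) (label_cost psiG psiH).
split=> [rho0|[g' Jg' g'0]]; first by exists g; rewrite -?rhoE.
apply/eqP; rewrite eq_le; apply/andP; split.
  rewrite -g'0; apply: ge_inf; last by exists g'.
  by exists 0 => _ [h Jh <-]; exact: joining_cost_ge0 Jh.
by rewrite /rho rhoE; exact: joining_cost_ge0 Jg.
Qed.

Lemma rho_ge0 (K : Type) (G H : graph R L) (psiG : G -> K) (psiH : H -> K) :
  0 <= rho psiG psiH.
Proof.
have [g Jg rhoE] := ogj_value_attained (weightP G) (weightP H) (label_cost psiG psiH).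
by rewrite /rho rhoE; apply: joining_cost_ge0 Jg; exact: label_cost_ge0.
Qed.

Lemma rho_process_eq0 (K : Type) (G H : graph R L) (psiG : G -> K)
    (psiH : H -> K) :
  fully_supported G -> fully_supported H ->
  rho (process_label psiG) (process_label psiH) = 0 <-> rho psiG psiH = 0.
Proof.
move=> fG fH; rewrite !rho_eq0; split=> -[g Jg g0]; exists g => //.
  by have [+ _] := zero_process_label_cost psiG psiH fG fH Jg; exact.
by have [_ +] := zero_process_label_cost psiG psiH fG fH Jg; exact.
Qed.

(** A zero-cost joining exists, so minimizers are compared with it. Optimality then depends only on
    the zero-cost joinings, which the two costs share. *)
Lemma rho_optimal_zero (K : Type) (G H : graph R L) (psiG : G -> K)
    (psiH : H -> K) :
  rho psiG psiH = 0 ->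
  rho_optimal psiG psiH = [set g |
    weight_joinings (@weight R L G) (@weight R L H) g /\
    joining_cost (label_cost psiG psiH) g = 0].
Proof.
move=> /rho_eq0[h Jh h0]; have c0 := @label_cost_ge0 _ _ _ psiG psiH.
apply/seteqP; split=> g [Jg gmin]; split=> //.
  by apply/eqP; rewrite eq_le (joining_cost_ge0 c0 Jg) andbT -h0 gmin.
by move=> g' Jg'; rewrite gmin; exact: joining_cost_ge0 Jg'.
Qed.

Lemma detects_process_scheme (K : Type) (F : graph R L -> Prop)
    (Psi : label_scheme R L K) :
  (forall G, F G -> fully_supported G) ->
  detects_isomorphism F (process_scheme Psi) <-> detects_isomorphism F Psi.
Proof.
move=> Ffull; split=> det G H FG FH; rewrite -(det G H FG FH).
  by apply: iff_sym; exact: rho_process_eq0 (Ffull _ FG) (Ffull _ FH).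
exact: rho_process_eq0 (Ffull _ FG) (Ffull _ FH).
Qed.

(** Detection gives value zero on isomorphic pairs for both costs, so both sides of the
    identification equation are the same sets for the two schemes. *)
Lemma identifies_process_scheme (K : Type) (F : graph R L -> Prop)
    (Psi : label_scheme R L K) :
  (forall G, F G -> fully_supported G) -> detects_isomorphism F Psi ->
  identifies_isomorphism F (process_scheme Psi) <->
  identifies_isomorphism F Psi.
Proof.
move=> Ffull det.
have same G H : F G -> F H -> isomorphic G H ->
    rho_optimal (process_scheme Psi (G := G)) (process_scheme Psi (G := H)) =
      rho_optimal (Psi G) (Psi H) /\
    [set g | [/\ weight_joinings (@weight R L G) (@weight R L H) g,
      bijective_joining g & joining_cost (label_cost
        (process_scheme Psi (G := G)) (process_scheme Psi (G := H))) g = 0]] =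
    [set g | [/\ weight_joinings (@weight R L G) (@weight R L H) g,
      bijective_joining g & joining_cost (label_cost (Psi G) (Psi H)) g = 0]].
  move=> FG FH GH; have fG := Ffull _ FG; have fH := Ffull _ FH.
  have rho0 : rho (Psi G) (Psi H) = 0 by apply/det.
  split.
    rewrite !rho_optimal_zero//; last exact/rho_process_eq0.
    by apply/seteqP; split=> g [Jg g0]; split=> //;
      apply/(zero_process_label_cost _ _ fG fH Jg).
  by apply/seteqP; split=> g [Jg bg g0]; split=> //;
    apply/(zero_process_label_cost _ _ fG fH Jg).
by split=> ident G H FG FH GH; have := ident G H FG FH GH;
  have [-> ->] := same G H FG FH GH.
Qed.

End ZeroCost.

Theorem theorem4p4 (R : realType) (L L' : Type) :
  (forall (G H : graph R L) (phiG' : G -> L') (phiH' : H -> L'),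
     fully_supported G -> fully_supported H ->
     let psiG := augmented phiG' in
     let psiH := augmented phiH' in
     (0 < rho psiG psiH)%R <->
     (0 < rho (process_label psiG) (process_label psiH))%R)
  /\
  (forall (F : graph R L -> Prop) (phi' : label_scheme R L L'),
     (forall G, F G -> fully_supported G) ->
     let Psi := augmented_scheme phi' in
     let PsiStar := process_scheme Psi in
     (detects_isomorphism F Psi /\ identifies_isomorphism F Psi) <->
     (detects_isomorphism F PsiStar /\ identifies_isomorphism F PsiStar)).
Proof.
split=> [G H phiG' phiH' fG fH psiG psiH|F phi' Ffull Psi PsiStar].
  (* Both values are nonnegative, so positivity amounts to being nonzero. *)
  rewrite !lt_def !rho_ge0 !andbT; split=> /eqP rho_n0; apply/eqP => rho0;
    apply: rho_n0.
    exact/(rho_process_eq0 psiG psiH fG fH).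
  exact/(rho_process_eq0 psiG psiH fG fH).
(* Detection is transferred first, since the transfer of identification relies on it. *)
rewrite (detects_process_scheme Psi Ffull).
by split=> -[det ident]; split=> //; apply/(identifies_process_scheme Ffull det).
Qed.
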